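(* Let $M$ be a matroid on a finite ground set $E$. Then the augmented Bergman complex $\Delta_M$ of $M$ is vertex decomposable.
   Context: For a matroid $M$ on $E$ with closure operator $f$, independent sets $I$ (those with $f(I\setminus\{i\})\subsetneq f(I)$ for all $i\in I$, equivalently the usual matroid independent sets) and flats (sets $F$ with $f(F)=F$), the augmented Bergman complex $\Delta_M$ is the simplicial complex with vertex set $\{y_i \mid i\in E\}\sqcup\{x_F \mid F \text{ a proper flat of } M\}$ (proper meaning $F\neq E$; the flat $f(\emptyset)$ is included), whose faces are the sets $\{y_i\mid i\in I\}\sqcup\{x_{F_1},\dots,x_{F_\ell}\}$ where $I$ is an independent set and $F_1\subsetneq F_2\subsetneq\cdots\subsetneq F_\ell\subsetneq E$ are flats with $f(I)\subseteq F_1$ ($\ell\ge 0$). A simplicial complex $\Delta$ is vertex decomposable if $\Delta$ is a simplex (including $\{\emptyset\}$), or inductively there is a vertex $v$ such that (i) the deletion $\mathrm{del}_\Delta(v)=\{\tau\setminus\{v\}\mid \tau\in\Delta\}$ and the link $\mathrm{link}_\Delta(v)=\{\tau\setminus\{v\}\mid v\in\tau\in\Delta\}$ are both vertex decomposable, and (ii) every facet of $\mathrm{del}_\Delta(v)$ is a facet of $\Delta$. *)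

(* Defs.v *)
From mathcomp Require Import all_boot.

Set Implicit Arguments.
Unset Strict Implicit.
Unset Printing Implicit Defensive.

(* A matroid on E, presented by its closure operator; the last field is the
   MacLane-Steinitz exchange axiom. *)
Record matroid (E : finType) := Matroid {
  closure :> {set E} -> {set E};
  closure_ext : forall A : {set E}, A \subset closure A;
  closure_mono : forall A B : {set E},
    A \subset B -> closure A \subset closure B;
  closure_idem : forall A : {set E}, closure (closure A) = closure A;
  closure_exchange : forall (A : {set E}) (i j : E),
    j \in closure (i |: A) -> j \notin closure A -> i \in closure (j |: A)
}.

Definition independent (E : finType) (M : matroid E) (I : {set E}) : bool :=
  [forall i in I, M (I :\ i) \proper M I].

Definition flat (E : finType) (M : matroid E) (F : {set E}) : bool :=
  M F == F.

Definition proper_flat (E : finType) (M : matroid E) (F : {set E}) : bool :=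
  flat M F && (F != [set: E]).

(* A simplicial complex is represented by its set of faces; elements v of V
   with [set v] not a face are allowed. *)
Section Complexes.

Variable V : finType.
Implicit Types (D : {set {set V}}) (v : V).

Definition simplicial_complex D : Prop :=
  set0 \in D /\ forall A B : {set V}, A \subset B -> B \in D -> A \in D.

Definition simplex D : Prop := exists A : {set V}, D = powerset A.

Definition facet D (A : {set V}) : bool := maxset [in D] A.

Definition deletion D v : {set {set V}} := [set A :\ v | A in D].

Definition link D v : {set {set V}} := [set A :\ v | A in D & v \in A].

Inductive vertex_decomposable : {set {set V}} -> Prop :=
| VD_simplex D : simplex D -> vertex_decomposable D
| VD_shed D v :
    [set v] \in D ->
    vertex_decomposable (deletion D v) ->
    vertex_decomposable (link D v) ->
    (forall A, facet (deletion D v) A -> facet D A) ->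
    vertex_decomposable D.

End Complexes.

(* inl i is the vertex y_i and inr F is the vertex x_F. *)
Definition aug_vertex (E : finType) (M : matroid E) : finType :=
  (E + {F : {set E} | proper_flat M F})%type.

Section AugmentedBergman.

Variables (E : finType) (M : matroid E).
Local Notation pflat := {F : {set E} | proper_flat M F}.

(* The face with independent part I and set of proper flats C. *)
Definition aug_face (I : {set E}) (C : {set pflat}) : {set aug_vertex M} :=
  [set (inl i : aug_vertex M) | i in I]
    :|: [set (inr F : aug_vertex M) | F in C].

(* The strict chain F_1 < ... < F_l is recorded by its underlying set C; the
   condition f(I) <= F_1 then reads f(I) <= F for all F in C. The explicit form
   is aug_bergmanP below. *)
Definition aug_bergman : {set {set aug_vertex M}} :=
  [set aug_face I C | I in [set: {set E}], C in [set: {set pflat}] &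
    [&& independent M I,
        [forall F in C, forall G in C,
           (val F \subset val G) || (val G \subset val F)]
      & [forall F in C, M I \subset val F]]].


Lemma aug_faceE (I : {set E}) (C : {set pflat}) (v : aug_vertex M) :
  (v \in aug_face I C) = match v with inl i => i \in I | inr F => F \in C end.
Proof.
rewrite inE; case: v => [i|F].
  rewrite (mem_imset _ _ (@inl_inj _ _)) orbC; case: imsetP => //.
  by case=> F _.
rewrite (mem_imset _ _ (@inr_inj _ _)); case: imsetP => //.
by case=> i _.
Qed.

Lemma aug_bergmanP (S : {set aug_vertex M}) :
  reflect
    (exists (I : {set E}) (s : seq pflat),
      [/\ independent M I,
          sorted (fun F G : pflat => val F \proper val G) s,
          (if s is F1 :: _ then M I \subset val F1 else true)
        & S = aug_face I [set F in s]])
    (S \in aug_bergman).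
Proof.
have sub_trans : transitive (fun F G : pflat => val F \subset val G).
  by move=> y x z; apply: subset_trans.
have prop_trans : transitive (fun F G : pflat => val F \proper val G).
  by move=> y x z; apply: proper_trans.
apply: (iffP imset2P) => [[I C _]|[I [s [indI srt hd ->]]]].
  rewrite !inE => /= /and3P[indI chC leC] ->.
  set le := fun F G : pflat => val F \subset val G.
  have srt : sorted le (sort le (enum C)).
    apply: (sort_sorted_in (P := mem C)).
      move=> F G FC GC.
      by move/forall_inP: chC => /(_ F FC)/forall_inP/(_ G GC).
    by apply/allP => F; rewrite mem_enum.
  exists I, (sort le (enum C)); split => //.
  - rewrite sorted_pairwise //.
    apply: (sub_pairwise (r := [rel F G | le F G && (F != G)])).
      move=> F G /= /andP[leFG neFG].
      by rewrite properEneq (inj_eq val_inj) neFG.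
    rewrite pairwise_relI -sorted_pairwise // srt /=.
    by rewrite -uniq_pairwise sort_uniq enum_uniq.
  - case def_s: (sort _ _) => [//|F s].
    have: F \in sort le (enum C) by rewrite def_s mem_head.
    by rewrite mem_sort mem_enum => FC; move/forall_inP: leC => ->.
  - by congr aug_face; apply/setP => F; rewrite inE mem_sort mem_enum.
exists I [set F in s] => //; rewrite !inE indI /=.
move: srt; rewrite sorted_pairwise // => pw.
apply/andP; split; last first.
  apply/forall_inP => F; rewrite inE.
  case: s hd pw => [//|G s] hd /= /andP[/allP ltG _].
  rewrite inE => /predU1P[-> //|/ltG/proper_sub].
  exact: subset_trans.
apply/forall_inP => F Fs; apply/forall_inP => G Gs; rewrite !inE in Fs Gs.
elim: s pw Fs Gs {hd} => [//|H s IHs] /= /andP[/allP ltH /IHs{}IHs].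
rewrite !inE => /predU1P[->|Fs] /predU1P[->|Gs]; rewrite ?subxx //.
- by rewrite (proper_sub (ltH _ Gs)).
- by rewrite (proper_sub (ltH _ Fs)) orbT.
exact: IHs.
Qed.

Lemma aug_bergman_complex : simplicial_complex aug_bergman.
Proof.
have memP (I : {set E}) (C : {set pflat}) : aug_face I C \in aug_bergman =
    [&& independent M I,
        [forall F in C, forall G in C,
           (val F \subset val G) || (val G \subset val F)]
      & [forall F in C, M I \subset val F]].
  apply/imset2P/idP => [[I' C' _]|H]; last by exists I C; rewrite ?inE.
  rewrite !inE /= => H eqS.
  have eqF v : (v \in aug_face I C) = (v \in aug_face I' C') by rewrite eqS.
  have -> : I = I' :> {set E}.
    by apply/setP => i; have := eqF (inl i); rewrite !aug_faceE.
  have -> // : C = C' :> {set pflat}.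
  by apply/setP => F; have := eqF (inr F); rewrite !aug_faceE.
have faceE (A : {set aug_vertex M}) :
    A = aug_face [set i | inl i \in A] [set F | inr F \in A].
  by apply/setP => -[i|F]; rewrite aug_faceE inE.
split.
  rewrite (faceE set0) memP; apply/and3P; split.
  - by apply/forall_inP => i; rewrite !inE.
  - by apply/forall_inP => F; rewrite !inE.
  - by apply/forall_inP => F; rewrite !inE.
move=> A B sAB; rewrite (faceE A) (faceE B) !memP.
move: {sAB}(subsetP sAB) => sAB.
set I := [set i | inl i \in A]; set J := [set i | inl i \in B].
set C := [set F | inr F \in A]; set D := [set F | inr F \in B].
have sIJ : I \subset J by apply/subsetP => i; rewrite !inE; apply: sAB.
have sCD F : F \in C -> F \in D by rewrite !inE; apply: sAB.
case/and3P=> /forall_inP indJ /forall_inP chD /forall_inP leD.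
apply/and3P; split.
- apply/forall_inP => i iI; have iJ := subsetP sIJ i iI.
  rewrite properE closure_mono ?subsetDl //=.
  apply: contra (proper_subn (indJ i iJ)) => sI.
  rewrite -(closure_idem M (J :\ i)); apply: closure_mono.
  apply/subsetP => j jJ; have [->|nji] := eqVneq j i.
    apply: (subsetP (closure_mono M (setSD [set i] sIJ))).
    by apply: (subsetP sI); apply: (subsetP (closure_ext M I)).
  by apply: (subsetP (closure_ext M _)); rewrite in_setD1 nji.
- apply/forall_inP => F /sCD/chD/forall_inP chF.
  by apply/forall_inP => G /sCD; apply: chF.
- apply/forall_inP => F /sCD/leD; apply: subset_trans.
  exact: closure_mono.
Qed.

End AugmentedBergman.

(* Main.v *)
Require Import Defs.
From mathcomp Require Import all_boot.

(* Write y_i and x_F for the vertices of Delta_M.  Shed the vertices x_F,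
   smallest flats first.  As long as the remaining flats form an up-set, every
     face that
   misses a minimal x_F but could be extended by it can be extended instead by
   some y_i with i in the next flat of its chain but not in F.  At the end the
   independence complex of M is left, and the link of x_F is the join of the
   independence complex of the restriction M | F with the order complex of the
   open interval (F, E) in the lattice of flats.

   The independence complex sheds any element that is neither a loop nor a
   coloop; deletion and link are independence complexes of minors.

   For an open interval (A, B) of flats, fix e in B \ A and shed the flats F
   avoiding e, largest first: a chain that could be extended by F can also be
   extended by the closure of G + e, where G is its largest member below F, or
     A.
   With M (A + e) for the closure of A + e, what is left is the cone with apex
   M (A + e) over (M (A + e), B), and the link of F is the join of (A, F) with
   such a cone in (F, B); when the apex would be B, the cone is replaced by the
   complex whose only face is empty. *)

Set Implicit Arguments.
Unset Strict Implicit.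
Unset Printing Implicit Defensive.

(** * Shedding vertices and joins of simplicial complexes *)

Section Shedding.

Variable V : finType.
Implicit Types (D : {set {set V}}) (A B S : {set V}) (v w : V).

Lemma deletionE D v A : simplicial_complex D ->
  (A \in deletion D v) = (v \notin A) && (A \in D).
Proof.
case=> _ sD; apply/imsetP/andP => [[B BD ->]|[vA AD]].
  by rewrite !inE eqxx (sD _ _ (subsetDl _ _) BD).
by exists A => //; apply/setP => w; rewrite !inE; case: eqVneq => // ->;
  apply/negbTE.
Qed.

Lemma linkE D v A : (A \in link D v) = (v \notin A) && (v |: A \in D).
Proof.
apply/imsetP/andP => [[B /[!inE] /andP[BD vB] ->]|[vA AD]].
  by rewrite !inE eqxx setD1K.
by exists (v |: A); rewrite ?inE ?eqxx ?andbT ?setU1K.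
Qed.

Lemma deletion_complex D v :
  simplicial_complex D -> simplicial_complex (deletion D v).
Proof.
move=> cD; have [D0 sD] := cD; split; first by rewrite deletionE ?inE.
move=> A B sAB; rewrite !deletionE // => /andP[vB BD].
by rewrite (sD _ _ sAB BD) andbT; apply: contra vB; apply: subsetP.
Qed.

Lemma link_complex D v : simplicial_complex D -> [set v] \in D ->
  simplicial_complex (link D v).
Proof.
move=> [_ sD] vD; split; first by rewrite linkE setU0 inE.
move=> A B sAB; rewrite !linkE // => /andP[vB BD].
rewrite (sD _ _ (setUS _ sAB) BD) andbT.
by apply: contra vB; apply: subsetP.
Qed.

(** Condition (ii) in exchange form: it is proved by exhibiting one vertex [w] instead of handling
    facets. *)
Definition shedding D v := forall A, v \notin A -> v |: A \in D ->
  exists2 w, w \notin v |: A & w |: A \in D.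

Lemma sheddingP D v : simplicial_complex D ->
  (shedding D v <-> forall A, facet (deletion D v) A -> facet D A).
Proof.
move=> cD; have [_ sD] := cD; split=> [shD A|fD A vA vAD].
  case/maxsetP=> /=; rewrite deletionE // => /andP[vA AD] maxA.
  apply/maxsetP; split; rewrite ?inE // => B BD sAB; apply: (maxA) => //=.
  (* A face above [A] containing [v] would yield a [w] with [w |: A] in the deletion, against the
     maximality of [A] there. *)
  rewrite deletionE // andbC BD /=; apply/negP => vB.
  have [|w] := shD A vA; first by apply: sD BD; rewrite subUset sub1set vB.
  rewrite !inE negb_or => /andP[wv wA] wAD.
  suff eA: w |: A = A by rewrite -eA !inE eqxx in wA.
  by apply: maxA (subsetUr _ _);
    rewrite ?inE /= deletionE // !inE eq_sym negb_or wv vA.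
have AD: A \in D by apply: sD vAD; apply: subsetUr.
have [w /andP[wA wAD]|noW] := pickP (fun w => (w \notin v |: A) && (w |: A \in
  D)).
  by exists w.
(* Without such a [w], [A] is a facet of the deletion and hence of [D], although [v |: A] is a
   larger face. *)
have /maxsetP[_ /(_ (v |: A))] : facet D A.
  apply: fD; apply/maxsetP=> /=; rewrite deletionE ?vA //=; split=> // B.
  move=> /=; rewrite deletionE // => /andP[vB BD] sAB.
  apply/eqP; rewrite eqEsubset sAB andbT; apply/subsetP => w wB.
  apply: contraFT (noW w) => wA; rewrite !inE negb_or wA andbT.
  rewrite (sD _ _ _ BD) ?subUset ?sub1set ?wB // andbT.
  by apply: contraNneq vB => <-.
move=> /= /(_ vAD (subsetUr _ _)) eA.
by rewrite -eA !inE eqxx in vA.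
Qed.

Lemma VD_shedding D v : simplicial_complex D -> [set v] \in D ->
  vertex_decomposable (deletion D v) -> vertex_decomposable (link D v) ->
  shedding D v -> vertex_decomposable D.
Proof.
by move=> cD vD vdd vdl sh; apply: VD_shed vdd vdl _ => //; apply/sheddingP.
Qed.

(** Both factors live on the one vertex type [V], and [S] tells their vertices apart: this is the
    simplicial join when the faces of [D1] lie in [S] and those of [D2] in its complement. *)
Definition join S D1 D2 : {set {set V}} :=
  [set A | (A :&: S \in D1) && (A :&: ~: S \in D2)].

Lemma joinC S D1 D2 : join S D1 D2 = join (~: S) D2 D1.
Proof. by apply/setP => A; rewrite !inE setCK andbC. Qed.

Lemma join_complex S D1 D2 : simplicial_complex D1 -> simplicial_complex D2 ->
  simplicial_complex (join S D1 D2).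
Proof.
move=> [D10 sD1] [D20 sD2]; split; first by rewrite inE !set0I D10.
move=> A B sAB; rewrite !inE => /andP[B1 B2].
by rewrite (sD1 _ _ (setSI _ sAB) B1) (sD2 _ _ (setSI _ sAB) B2).
Qed.

(** Since [v] lies in [S], its deletion and link change only the first factor, and the vertex that
    replaces [v] lies in [S] as well. *)
Lemma VD_join_shedding S D1 D2 v :
  simplicial_complex D1 -> simplicial_complex D2 ->
  (forall A, A \in D1 -> A \subset S) -> [set v] \in D1 ->
  vertex_decomposable (join S (deletion D1 v) D2) ->
  vertex_decomposable (join S (link D1 v) D2) ->
  shedding D1 v -> vertex_decomposable (join S D1 D2).
Proof.
move=> cD1 cD2 sS vD1 vdd vdl sh.
have inS w A : w |: A \in D1 -> w \in S.
  by move/sS; rewrite subUset sub1set => /andP[].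
have vS : v \in S by apply: (inS v set0); rewrite setU0.
have UI w A : w \in S -> (w |: A) :&: S = w |: (A :&: S).
  by move=> wS; rewrite setIUl (setIidPl _) ?sub1set.
have UIC w A : w \in S -> (w |: A) :&: ~: S = A :&: ~: S.
  move=> wS; rewrite setIUl; apply/setUidPr/subsetP => x; rewrite !inE.
  by case/andP=> /eqP->; rewrite wS.
have cJ := join_complex S cD1 cD2.
apply: (VD_shedding (v := v)) => //.
- by rewrite -(setU0 [set v]) inE UI // UIC // !set0I setU0 vD1 cD2.1.
- suff -> : deletion (join S D1 D2) v = join S (deletion D1 v) D2 by [].
  by apply/setP => A; rewrite deletionE // !inE deletionE // inE vS andbT andbA.
- suff -> : link (join S D1 D2) v = join S (link D1 v) D2 by [].
  by apply/setP => A;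
    rewrite linkE // !inE linkE // inE vS andbT UI // UIC // andbA.
move=> A vA; rewrite inE UI // UIC // => /andP[vAD AD2].
have [|w] := sh _ _ vAD; first by rewrite inE (negPf vA).
move=> wA wAD; have wS := inS _ _ wAD.
exists w; last by rewrite inE UI // UIC // wAD.
by move: wA; rewrite !inE wS andbT.
Qed.

Lemma powerset_complex A : simplicial_complex (powerset A).
Proof.
split; first by rewrite inE sub0set.
by move=> B C sBC; rewrite !inE; apply: subset_trans.
Qed.

(** Induction on the decomposition of [D1]; once [D1] is a simplex, induction on that of [D2],
    ending with two simplices, whose join is the simplex on the union. *)
Lemma VD_join S D1 D2 : simplicial_complex D1 -> simplicial_complex D2 ->
  (forall A, A \in D1 -> A \subset S) -> (forall A, A \in D2 -> A \subset ~: S)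
    ->
  vertex_decomposable D1 -> vertex_decomposable D2 ->
  vertex_decomposable (join S D1 D2).
Proof.
have sub_del D (T : {set V}) v : simplicial_complex D ->
    (forall A, A \in D -> A \subset T) ->
    forall A, A \in deletion D v -> A \subset T.
  by move=> cD sT A; rewrite deletionE // => /andP[_ /sT].
have sub_link D (T : {set V}) v : (forall A, A \in D -> A \subset T) ->
    forall A, A \in link D v -> A \subset T.
  by move=> sT A; rewrite linkE => /andP[_ /sT]; rewrite subUset => /andP[].
move=> cD1 cD2 s1 s2 vd1 vd2.
elim: vd1 cD1 s1 => {D1} [D1 [A ->]|D1 v vD1 _ IHd _ IHl /[swap] cD1].
  elim: vd2 cD2 s2 => {D2} [D2 [B ->]|D2 v vD2 _ IHd _ IHl /[swap] cD2].
    move=> _ sB _ sA; apply: VD_simplex; exists (A :|: B).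
    have {}sA : A \subset S by apply: sA; rewrite powersetE.
    have {}sB : B \subset ~: S by apply: sB; rewrite powersetE.
    apply/setP => X; rewrite !inE; apply/andP/idP => [[XA XB]|sX].
      by rewrite -(setID X S) setDE setUSS.
    split; apply/subsetP => x; rewrite !inE => /andP[/(subsetP sX)].
      by rewrite inE => /orP[//|/(subsetP sB)]; rewrite inE => /negPf->.
    by rewrite inE => /orP[/(subsetP sA)->|].
  (* Swapping the factors lets a shedding vertex of [D2] be treated as one of the first factor. *)
  move=> /(sheddingP v cD2) sh s2 cA sA; rewrite joinC.
  apply: VD_join_shedding sh => //; rewrite joinC setCK.
    by apply: IHd => //; [apply: deletion_complex|apply: sub_del].
  by apply: IHl => //; [apply: link_complex|apply: sub_link].
move=> /(sheddingP v cD1) sh s1.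
apply: VD_join_shedding sh => //.
  by apply: IHd => //; [apply: deletion_complex|apply: sub_del].
by apply: IHl => //; [apply: link_complex|apply: sub_link].
Qed.

End Shedding.

(** * Transport of complexes along an injection of vertices *)

Section Pushforward.

Variables (T V : finType) (f : T -> V).
Hypothesis injf : injective f.
Implicit Types (D : {set {set T}}).

(** Without the inclusion in the image, every vertex outside the image of [f] would be a cone
    point. *)
Definition push D : {set {set V}} :=
  [set A : {set V} | (A \subset f @: setT) && (f @^-1: A \in D)].

Lemma mem_push D (A : {set V}) :
  (A \in push D) = (A \subset f @: setT) && (f @^-1: A \in D).
Proof. by rewrite inE. Qed.

Lemma push_complex D : simplicial_complex D -> simplicial_complex (push D).
Proof.
move=> [D0 sD]; split.
  by rewrite inE preimset0 D0 andbT; apply/subsetP => x; rewrite inE.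
move=> A B sAB; rewrite !inE => /andP[sB BD].
by rewrite (subset_trans sAB sB) (sD _ _ (preimsetS f sAB) BD).
Qed.

(** By injectivity, deletion and link at [f x] are the pushes of deletion and link at [x], and the
    simplex on [A] becomes the simplex on [f @: A]. *)
Lemma VD_push D : simplicial_complex D -> vertex_decomposable D ->
  vertex_decomposable (push D).
Proof.
have fU x (A : {set V}) : f @^-1: (f x |: A) = x |: f @^-1: A.
  by apply/setP => y; rewrite !inE (inj_eq injf).
have sU x (A : {set V}) : (f x |: A \subset f @: setT) = (A \subset f @: setT).
  by rewrite subUset sub1set imset_f.
move=> cD vd; elim: vd cD => {D} [D [A ->] _|D x xD _ IHd _ IHl /[swap] cD].
  apply: VD_simplex; exists (f @: A); apply/setP => B; rewrite !inE.
  apply/andP/subsetP => [[/subsetP sB /subsetP sA] v vB|sB]; last first.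
    split; apply/subsetP => v; last by rewrite inE => /sB; rewrite mem_imset.
    by case/sB/imsetP=> x _ ->; apply: imset_f.
  have /imsetP[x _ def_v] := sB v vB; rewrite def_v in vB *.
  by apply: imset_f; apply: sA; rewrite inE.
move=> /(sheddingP x cD) sh; have cP := push_complex cD.
apply: (VD_shedding (v := f x)) => //.
- rewrite -(setU0 [set f x]) inE fU sU preimset0 setU0 xD andbT.
  by apply/subsetP => v; rewrite inE.
- suff -> : deletion (push D) (f x) = push (deletion D x).
    by apply: IHd; apply: deletion_complex.
  by apply/setP => A; rewrite deletionE // !inE deletionE // inE andbCA.
- suff -> : link (push D) (f x) = push (link D x).
    by apply: IHl; apply: link_complex.
  by apply/setP => A; rewrite linkE // !inE linkE // sU fU inE andbCA.
move=> A xA; rewrite inE sU fU => /andP[sA xAD].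
have [|y] := sh _ _ xAD; first by rewrite inE.
move=> yA yAD; exists (f y); last by rewrite inE sU fU sA.
by move: yA; rewrite !inE (inj_eq injf).
Qed.

End Pushforward.

(** * Clique complexes of a reflexive symmetric relation *)

Section CliqueComplex.

Variables (T : finType) (r : rel T).
Hypotheses (r_refl : reflexive r) (r_sym : symmetric r).
Implicit Types (C U W : {set T}).

(** For comparability of flats this is an order complex. The vertex set [W] is a parameter because
    deletion and link of a vertex only shrink it. *)
Definition cliques W : {set {set T}} :=
  [set C : {set T} | (C \subset W) && [forall x in C, forall y in C, r x y]].

Lemma cliquesP W C : reflect (C \subset W /\ {in C &, forall x y, r x y})
  (C \in cliques W).
Proof.
rewrite inE; apply: (iffP andP) => -[sC rC]; split=> //.
  by move=> x y xC yC; move/forall_inP: rC => /(_ x xC)/forall_inP; apply.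
by apply/forall_inP => x xC; apply/forall_inP => y yC; apply: rC.
Qed.

Lemma cliques_complex W : simplicial_complex (cliques W).
Proof.
split; first by apply/cliquesP; split; rewrite ?sub0set // => x y; rewrite inE.
move=> A B /[dup] /subsetP sAB sAB' /cliquesP[sB rB]; apply/cliquesP.
by split=> [|x y /sAB xB /sAB yB]; [apply: subset_trans sB|apply: rB].
Qed.

Lemma cliquesU1 W C x : (x |: C \in cliques W) =
  [&& x \in W, C \in cliques W & [forall y in C, r x y]].
Proof.
apply/cliquesP/and3P => [[]|[xW /cliquesP[sC rC] /forall_inP rx]].
  rewrite subUset sub1set => /andP[xW sC] rC; split=> //.
    by apply/cliquesP; split=> // y z yC zC; apply: rC;
      rewrite !inE ?yC ?zC orbT.
  by apply/forall_inP => y yC; apply: rC; rewrite !inE ?eqxx ?yC ?orbT.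
rewrite subUset sub1set xW; split=> // y z.
move=> /setU1P[->|yC] /setU1P[->|zC] //; [exact: rx|rewrite r_sym;
  exact: rx|exact: rC].
Qed.

Lemma deletion_cliques W x : deletion (cliques W) x = cliques (W :\ x).
Proof.
apply/setP => C; rewrite deletionE; last exact: cliques_complex.
by rewrite !inE subsetD1 andbA; congr (_ && _); rewrite andbC.
Qed.

Lemma link_cliques W x : x \in W ->
  link (cliques W) x = cliques [set y in W :\ x | r x y].
Proof.
move=> xW; apply/setP => C; rewrite linkE cliquesU1 xW /=.
apply/and3P/cliquesP => [[xC /cliquesP[sC rC] /forall_inP rx]|[sC rC]].
  split=> //; apply/subsetP => y yC; rewrite !inE (subsetP sC) // rx // !andbT.
  by apply: contraNneq xC => <-.
split.
- by apply/negP => /(subsetP sC); rewrite !inE eqxx.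
- apply/cliquesP; split=> //; apply/subsetP => y /(subsetP sC).
  by rewrite !inE => /andP[/andP[]].
- by apply/forall_inP => y /(subsetP sC); rewrite !inE => /andP[].
Qed.

Lemma VD_cliques0 : vertex_decomposable (cliques set0).
Proof.
apply: VD_simplex; exists set0; apply/setP => C; rewrite powersetE.
apply/cliquesP/idP => [[]//|sC]; split=> // x y /(subsetP sC).
by rewrite inE.
Qed.

Lemma VD_cliques1 x : vertex_decomposable (cliques [set x]).
Proof.
apply: VD_simplex; exists [set x]; apply/setP => C; rewrite powersetE.
apply/cliquesP/idP => [[]//|sC];
  split=> // y z /(subsetP sC)/set1P-> /(subsetP sC).
by move/set1P->.
Qed.

(** As all pairs across [U] and [W] are related, a set is a clique exactly when its two parts are,
    so the complex is a join. *)
Lemma VD_cliquesU U W : [disjoint U & W] ->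
  {in U & W, forall x y, r x y} -> vertex_decomposable (cliques U) ->
  vertex_decomposable (cliques W) -> vertex_decomposable (cliques (U :|: W)).
Proof.
move=> dUW rUW vdU vdW.
have nW x : x \in U -> x \notin W by move=> xU; apply/negbT/(disjointFr dUW).
suff -> : cliques (U :|: W) = join U (cliques U) (cliques W).
  apply: VD_join => // [||A /cliquesP[]//|A /cliquesP[sA _]];
    try exact: cliques_complex.
  by apply: subset_trans sA _; rewrite -disjoints_subset disjoint_sym.
apply/setP => C; rewrite [RHS]inE.
apply/cliquesP/andP => [[/subsetP sC rC]|[/cliquesP[_ rU] /cliquesP[/subsetP sW
  rW]]].
  split; apply/cliquesP; split; rewrite ?subsetIr //.
  - by move=> x y /setIP[xC _] /setIP[yC _]; apply: rC.
  - apply/subsetP => x; rewrite !inE => /andP[/sC]; rewrite inE.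
    by case: (x \in U).
  - by move=> x y /setIP[xC _] /setIP[yC _]; apply: rC.
have inW x : x \in C -> x \notin U -> x \in W.
  by move=> xC xU; apply: sW; rewrite !inE xC.
split; first by apply/subsetP => x xC; rewrite inE -implyNb; apply/implyP/inW.
move=> x y xC yC; have [xU|xU] := boolP (x \in U);
  have [yU|yU] := boolP (y \in U).
- by apply: rU; rewrite inE ?xC ?yC.
- by apply: rUW => //; apply: inW.
- by rewrite r_sym; apply: rUW => //; apply: inW.
- by apply: rW; rewrite !inE ?xC ?yC.
Qed.

End CliqueComplex.

(** * Independence complexes of matroid minors *)

Section MatroidClosure.

Variables (E : finType) (M : matroid E).
Implicit Types (A B I K R : {set E}) (i j : E).

Lemma closure_sub A B : M B = B -> A \subset B -> M A \subset B.
Proof. by move=> <- ?; rewrite -(closure_idem M B) closure_mono. Qed.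

Lemma independentE I : independent M I = [forall i in I, i \notin M (I :\ i)].
Proof.
apply: eq_forallb_in => i iI; rewrite properE closure_mono ?subsetDl //=.
apply/idP/idP; apply: contra; [move=> iM|move=> sM].
  apply: closure_sub; first exact: closure_idem.
  by rewrite -{1}(setD1K iI) subUset sub1set iM closure_ext.
by apply: (subsetP sM); apply: (subsetP (closure_ext M I)).
Qed.

(* The independent subsets of R in the contraction M / K. *)
Definition minor_independent K R : {set {set E}} :=
  [set I : {set E} | (I \subset R) &&
     [forall i in I, i \notin M (K :|: (I :\ i))]].

Lemma minor_independentP K R I :
  reflect (I \subset R /\ {in I, forall i, i \notin M (K :|: (I :\ i))})
          (I \in minor_independent K R).
Proof.
rewrite inE; apply: (iffP andP) => -[sI nI]; split=> //.
  by move=> i iI; move/forall_inP: nI; apply.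
exact/forall_inP.
Qed.

Lemma minor_independent_complex K R :
  simplicial_complex (minor_independent K R).
Proof.
split; first by apply/minor_independentP; split; rewrite ?sub0set // => i;
  rewrite inE.
move=> I J sIJ /minor_independentP[sJ nJ]; apply/minor_independentP.
split=> [|i iI]; first exact: subset_trans sJ.
apply: contra (nJ i (subsetP sIJ i iI)).
by apply: subsetP; apply: closure_mono; apply/setUS/setSD.
Qed.

(** If adding [i] made some [j] in [I] dependent on the rest, exchange would put [i] in the closure
    of [K :|: I]. *)
Lemma minor_independentU1 K R I i : i \notin I -> i |: I \subset R ->
  I \in minor_independent K R ->
  (i |: I \in minor_independent K R) = (i \notin M (K :|: I)).
Proof.
move=> iI sIR /minor_independentP[_ nI].
apply/minor_independentP/idP => [[_ /(_ i (setU11 _ _))]|niKI].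
  by rewrite setU1K.
split=> // j; case/setU1P=> [->|jI]; first by rewrite setU1K.
have ji : j != i by apply: contraNneq iI => <-.
have eI : j |: (K :|: I :\ j) = K :|: I by rewrite setUCA setD1K.
have eiI : K :|: (i |: I) :\ j = i |: (K :|: I :\ j).
  rewrite setUCA; congr (_ :|: _); apply/setP => x; rewrite !inE.
  by case: (x =P i) => [->|]; rewrite ?(eq_sym i) ?ji.
apply: contra niKI; rewrite eiI -eI => jM.
by apply: closure_exchange jM _; apply: nI.
Qed.

Lemma deletion_minor_independent K R i :
  deletion (minor_independent K R) i = minor_independent K (R :\ i).
Proof.
apply/setP => I; rewrite deletionE; last exact: minor_independent_complex.
by rewrite !inE subsetD1 andbA; congr (_ && _); rewrite andbC.
Qed.

Lemma link_minor_independent K R i : i \in R -> i \notin M K ->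
  link (minor_independent K R) i = minor_independent (i |: K) (R :\ i).
Proof.
move=> iR iK; apply/setP => I; rewrite linkE.
apply/andP/minor_independentP => [[iI /minor_independentP[]]|].
  rewrite subUset sub1set subsetD1 iI => /andP[_ sI] nI; split=> [|j jI].
    by rewrite sI.
  have /nI : j \in i |: I by rewrite inE jI orbT.
  apply: contra; apply: subsetP; apply: closure_mono.
  rewrite -setUA setUCA setUS //; apply/subsetP => x; rewrite !inE.
  case: (x =P i) => [->|_] /=; last by case/andP=> -> ->.
  by rewrite andbT => _; apply: contraNneq iI => ->.
rewrite subsetD1 => -[/andP[sI iI] nI]; split=> //.
have IK : I \in minor_independent K R.
  apply/minor_independentP; split=> // j jI; apply: contra (nI j jI).
  by apply: subsetP; apply: closure_mono; rewrite setSU ?subsetUr.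
rewrite minor_independentU1 // ?subUset ?sub1set ?iR //.
(* A maximal subset of I whose closure over K avoids i is all of I. *)
have [|J /maxsetP[/andP[sJ iJ] maxJ] _] := @maxset_exists _
  (fun J : {set E} => (J \subset I) && (i \notin M (K :|: J))) set0.
  by rewrite sub0set setU0.
have [<- //|neJI] := eqVneq J I.
have /properP[_ [j jI jJ]] : J \proper I by rewrite properEneq neJI.
case/negP: (nI j jI).
(* By maximality of [J], adding [j] spans [i]; exchange then puts [j] in the closure of [i], [K] and
   [J], against the independence of [I] over [i |: K]. *)
have jM : i \in M (j |: (K :|: J)).
  apply: contraT => niM; suff eJ : j |: J = J by rewrite -eJ setU11 in jJ.
  apply: maxJ (subsetUr _ _).
  by rewrite subUset sub1set jI sJ setUCA.
apply: subsetP (closure_exchange jM iJ); apply: closure_mono.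
rewrite setUA setUS //; apply/subsetP => x xJ; rewrite !inE (subsetP sJ) //.
by rewrite andbT; apply: contraNneq jJ => <-.
Qed.

(* If every element is a loop or a coloop, the complex is the simplex on the
   coloops. *)
Lemma VD_minor_independent K R : vertex_decomposable (minor_independent K R).
Proof.
have [n] := ubnP #|R|; elim: n K R => // n IHn K R /ltnSE leRn.
have cD := minor_independent_complex K R.
(* In [M / K] restricted to [R], [iK] says that [i] is no loop and [iKR] that it is no coloop. *)
have [i /and3P[iR iK iKR]|coloop] :=
  pickP (fun i => [&& i \in R, i \notin M K & i \in M (K :|: R :\ i)]);
    last first.
  apply: VD_simplex; exists [set i in R | i \notin M K].
  apply/setP => I; rewrite powersetE.
  apply/minor_independentP/subsetP => [[sI nI] i iI|sI].
    rewrite inE (subsetP sI) //; apply: contra (nI i iI).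
    by apply: subsetP; apply/closure_mono/subsetUl.
  split=> [|i /[dup] iI /sI]; first by apply/subsetP => i /sI;
    rewrite inE => /andP[].
  rewrite inE => /andP[iR iK]; move/negbT: (coloop i); rewrite iR iK /=.
  apply: contra; apply: subsetP;
    apply/closure_mono/setUS/setSD/subsetP => j /sI.
  by rewrite inE => /andP[].
have ltR : #|R :\ i| < n by rewrite (leq_trans _ leRn) // [leqRHS](cardsD1 i)
  iR.
apply: (VD_shedding (v := i)) => //.
- rewrite -(setU0 [set i]) minor_independentU1 ?setU0 ?sub1set ?in_set0 //.
  exact: cD.1.
- by rewrite deletion_minor_independent; apply: IHn.
- by rewrite link_minor_independent //; apply: IHn.
move=> I iI iID; have ID : I \in minor_independent K R.
  by apply: cD.2 iID; apply: subsetUr.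
have [siI _] := minor_independentP _ _ _ iID.
have niI : i \notin M (K :|: I) by rewrite -(minor_independentU1 iI siI).
(* If [K :|: I] spanned all of [R :\ i], it would also span [i], which is no coloop. *)
have [j /andP[jR jM]|sR] :=
    pickP (fun j => (j \in R :\ i) && (j \notin M (K :|: I))).
  have [ji {}jR] := setD1P jR.
  have jI : j \notin I.
    by apply: contra jM => jI; apply: (subsetP (closure_ext _ _));
      rewrite inE jI orbT.
  exists j; first by rewrite !inE negb_or ji.
  rewrite minor_independentU1 //.
  by move: siI; rewrite !subUset !sub1set jR => /andP[].
case/negP: niI; apply: subsetP iKR; apply: closure_sub (closure_idem _ _) _.
rewrite subUset (subset_trans (subsetUl _ _) (closure_ext _ _)) /=.
by apply/subsetP => j jR; move/negbT: (sR j); rewrite jR /= negbK.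
Qed.

End MatroidClosure.

(** * Order complexes of open intervals of flats *)

Section FlatChains.

Variables (E : finType) (M : matroid E).
Local Notation pflat := {F : {set E} | proper_flat M F}.
Implicit Types (A B X : {set E}) (F G H : pflat) (C U : {set pflat}).

Definition comparable F G := (val F \subset val G) || (val G \subset val F).

Local Notation chains := (cliques comparable).

Lemma comparable_refl : reflexive comparable.
Proof. by move=> F; rewrite /comparable subxx. Qed.

Lemma comparable_sym : symmetric comparable.
Proof. by move=> F G; rewrite /comparable orbC. Qed.

Lemma pflat_closure F : M (val F) = val F.
Proof. by case: F => F /= /andP[/eqP]. Qed.

Lemma proper_flatI X B : M X = X -> X \proper B -> proper_flat M X.
Proof.
move=> fX XB; rewrite /proper_flat /flat fX eqxx /= -properT.
by rewrite (proper_sub_trans XB) ?subsetT.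
Qed.

Definition flat_interval A B : {set pflat} :=
  [set F : pflat | (A \proper val F) && (val F \proper B)].

(** A flat above [A] contains [e] exactly when it contains [M (e |: A)]. If the latter is [B], no
    vertex is left; otherwise it is a vertex comparable with all others, a cone point. *)
Lemma VD_interval_above A B e : M A = A -> M B = B -> A \subset B ->
  e \in B -> e \notin A ->
  vertex_decomposable (chains (flat_interval (M (e |: A)) B)) ->
  vertex_decomposable (chains [set F in flat_interval A B | e \in val F]).
Proof.
move=> fA fB sAB eB eA vd.
have sAeA : A \subset M (e |: A).
  by apply: subset_trans (closure_ext _ _); apply: subsetUr.
have eeA : e \in M (e |: A) by apply: (subsetP (closure_ext _ _));
  apply: setU11.
have ltA X : A \subset X -> e \in X -> A \proper X.
  by move=> sAX eX; apply/properP; split=> //; exists e.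
have [eAB|neAB] := eqVneq (M (e |: A)) B.
  suff -> : [set F in flat_interval A B | e \in val F] = set0 by apply:
    VD_cliques0.
  apply/setP => F; rewrite !inE; apply/negP => /andP[/andP[AF FB] eF].
  case/negP: (proper_subn FB); rewrite -eAB;
    apply: closure_sub (pflat_closure F) _.
  by rewrite subUset sub1set eF proper_sub.
have ltAB : M (e |: A) \proper B.
  by rewrite properEneq neAB closure_sub // subUset sub1set eB.
pose F0 : pflat := exist (proper_flat M) _ (proper_flatI (closure_idem M _)
  ltAB).
have -> : [set F in flat_interval A B | e \in val F] =
    [set F0] :|: flat_interval (val F0) B.
  apply/setP => F; rewrite !inE; have [->|neF] := eqVneq F F0.
    by rewrite /= ltA //= ltAB eeA.
  rewrite /=; apply/andP/andP => [[/andP[AF FB] eF]|[F0F FB]].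
    split=> //; rewrite properEneq -(inj_eq val_inj) eq_sym neF /=.
    apply: closure_sub (pflat_closure F) _.
    by rewrite subUset sub1set eF proper_sub.
  by rewrite FB (sub_proper_trans sAeA) // (subsetP (proper_sub F0F)).
apply: VD_cliquesU => //.
- exact: comparable_sym.
- by rewrite disjoints_subset sub1set !inE properxx.
- by move=> F G /set1P->; rewrite inE /comparable => /andP[/proper_sub-> _].
- by apply: VD_cliques1; apply: comparable_refl.
Qed.

(** [X] is the largest member of [C] strictly below [F], or [A] if there is none. *)
Lemma chain_pred A F C : M A = A -> A \proper val F ->
  {in C, forall G, A \subset val G} ->
  {in C &, forall G H, comparable G H} ->
  exists X, [/\ M X = X, A \subset X, X \proper val F &
    {in C, forall G, val G \proper val F -> val G \subset X}].
Proof.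
move=> fA AF sAC chC; pose C' := [set G in C | val G \proper val F].
have [C0|[G0 G0C']] := set_0Vmem C'.
  exists A; split=> // G GC GF; suff: G \in C' by rewrite C0 inE.
  by rewrite inE GC.
have [G] := @arg_maxnP _ G0 (mem C') (fun G => #|val G|) G0C'.
rewrite /= inE => /andP[GC GF] maxG; exists (val G); split=> //.
- exact: pflat_closure.
- exact: sAC.
move=> H HC HF; have /orP[//|sGH] := chC _ _ HC GC.
have leHG : #|val H| <= #|val G| by apply: maxG; rewrite inE HC.
suff /eqP-> : val G == val H by [].
by rewrite eqEcard sGH.
Qed.

Lemma VD_flat_interval A B : M A = A -> M B = B -> A \subset B ->
  vertex_decomposable (chains (flat_interval A B)).
Proof.
have [n] := ubnP #|B :\: A|; elim: n A B => // n IHn A B /ltnSE leABn fA fB sAB.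
have [BA0|[e]] := set_0Vmem (B :\: A).
  suff -> : flat_interval A B = set0 by apply: VD_cliques0.
  apply/setP => F; rewrite !inE; apply/negP => /andP[AF FB].
  have := proper_subn (proper_trans AF FB).
  by rewrite -setD_eq0 BA0 eqxx.
rewrite inE => /andP[eA eB].
have IHlt X Y : M X = X -> M Y = Y -> A \subset X -> X \subset Y ->
    Y \subset B -> (A \proper X) || (Y \proper B) ->
    vertex_decomposable (chains (flat_interval X Y)).
  move=> fX fY sAX sXY sYB lt; apply: IHn => //; apply: leq_trans leABn.
  apply: proper_card; apply/properP; split; first exact: setDSS.
  case/orP: lt => /properP[_ [x]].
    move=> xX xA; exists x; rewrite !inE ?xA ?xX //=.
    by rewrite (subsetP sYB) // (subsetP sXY).
  move=> xB xY; exists x; rewrite !inE ?(negPf xY) ?andbF // xB andbT.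
  by apply: contra xY => xA; rewrite (subsetP sXY) // (subsetP sAX).
have VD_above X : M X = X -> A \subset X -> X \subset B -> e \notin X ->
    vertex_decomposable (chains [set F in flat_interval X B | e \in val F]).
  move=> fX sAX sXB eX; apply: VD_interval_above => //.
  have eeX : e \in M (e |: X) by apply: (subsetP (closure_ext _ _));
    apply: setU11.
  have sXeX : X \subset M (e |: X).
    by apply: subset_trans (closure_ext _ _); apply: subsetUr.
  apply: IHlt => //; rewrite ?closure_idem ?(subset_trans sAX) //.
    by rewrite closure_sub // subUset sub1set eB.
  by apply/orP; left; apply/properP; split; [apply: subset_trans sXeX|exists e].
(* [U] is what remains of the interval during the shedding: all its flats containing [e], and a
   down-closed family of those avoiding [e]. *)
suff VD_U U : U \subset flat_interval A B ->
    {in flat_interval A B, forall F, e \in val F -> F \in U} ->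
    {in U & flat_interval A B, forall F G,
       e \notin val F -> val G \subset val F -> G \in U} ->
    vertex_decomposable (chains U).
  by apply: VD_U.
have [m] := ubnP #|U|; elim: m U => // m IHm U /ltnSE leUm sU inU downU.
have [U0|[F0 F0U]] := set_0Vmem [set F in U | e \notin val F].
  suff -> : U = [set F in flat_interval A B | e \in val F] by apply: VD_above.
  apply/setP => F; rewrite inE; apply/idP/andP => [FU|[]]; last exact: inU.
  split; first exact: (subsetP sU).
  by apply: contraT => eF; rewrite -(in_set0 F) -U0 inE FU.
(* Any larger flat in [U] then contains [e], so removing [F] keeps the family of flats avoiding [e]
   down-closed. *)
have [F] := @arg_maxnP _ F0 (mem [set F in U | e \notin val F])
  (fun F => #|val F|) F0U.
rewrite /= inE => /andP[FU eF] maxF {F0 F0U}.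
have aboveF G : G \in U -> val F \subset val G -> G != F -> e \in val G.
  move=> GU sFG; apply: contraR => eG;
    rewrite -(inj_eq val_inj) eq_sym eqEcard sFG.
  by apply: maxF; rewrite inE GU.
have:= subsetP sU _ FU; rewrite inE => /andP[AF FB].
have sAG G : G \in U -> A \subset val G.
  by move/(subsetP sU); rewrite inE => /andP[/proper_sub].
have sGB G : G \in U -> val G \proper B.
  by move/(subsetP sU); rewrite inE => /andP[].
apply: (VD_shedding (v := F)).
- exact: cliques_complex.
- rewrite -(setU0 [set F]) (cliquesU1 comparable_refl comparable_sym).
  rewrite FU (cliques_complex _ _).1; apply/forall_inP => G; by rewrite inE.
- rewrite deletion_cliques; apply: IHm.
  + by apply: leq_trans leUm; rewrite [ltnRHS](cardsD1 F) FU.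
  + by apply: subset_trans sU; apply: subsetDl.
  + move=> G GI eG; rewrite !inE inU // andbT.
    by apply: contraNneq eF => <-.
  + move=> G H /setD1P[neGF GU] HI eG sHG; rewrite !inE (downU G) // andbT.
    apply: contraNneq eG => eHF; apply: aboveF => //; by rewrite -eHF.
- rewrite (link_cliques comparable_refl comparable_sym) //.
  (* Below [F], [U] still has the whole interval; above [F] it has just the flats containing [e].
     The two parts are mutually comparable, so the link is a join. *)
  have -> : [set G in U :\ F | comparable F G] =
      flat_interval A (val F) :|: [set G in flat_interval (val F) B | e \in val
        G].
    apply/setP => G; rewrite !inE.
    apply/andP/orP => [[/andP[neGF GU] /orP[sFG|sGF]]|[/andP[AG GF]|]].
    - right; rewrite sGB // (aboveF G) // properEneq sFG (inj_eq val_inj)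
      eq_sym.
      by rewrite neGF.
    - left; rewrite [val G \proper _]properEneq sGF (inj_eq val_inj) neGF
      !andbT.
      by move/(subsetP sU): GU; rewrite inE => /andP[].
    - rewrite /comparable (proper_sub GF) orbT -(inj_eq val_inj) (proper_neq
      GF).
      by rewrite (downU F) // ?inE ?AG ?(proper_trans GF) // proper_sub.
    - case/andP=> /andP[FG GB] eG; rewrite /comparable (proper_sub FG).
      rewrite -(inj_eq val_inj) eq_sym (proper_neq FG).
      by rewrite inU // inE GB (proper_trans AF).
  apply: VD_cliquesU.
  + exact: comparable_sym.
  + rewrite disjoints_subset; apply/subsetP => G; rewrite !inE => /andP[_ GF].
    apply: contraL GF => /andP[/andP[FG _] _].
    by rewrite properE negb_and negbK (proper_sub FG) orbT.
  + move=> G H; rewrite !inE => /andP[_ GF] /andP[/andP[FH _] _].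
    by rewrite /comparable (subset_trans (proper_sub GF) (proper_sub FH)).
  + by apply: IHlt; rewrite ?pflat_closure ?subxx ?FB ?orbT // proper_sub.
  + by apply: VD_above; rewrite ?pflat_closure // proper_sub.
move=> C FC; rewrite (cliquesU1 comparable_refl comparable_sym).
case/and3P=> _ /cliquesP[sC chC] /forall_inP chF.
have [X [fX sAX XF maxX]] : exists X, [/\ M X = X, A \subset X,
    X \proper val F & {in C, forall G, val G \proper val F -> val G \subset X}].
  by apply: chain_pred => // G /(subsetP sC)/sAG.
(* The replacement for [F]: the least flat containing [e] and the predecessor [X] of [F]. *)
pose Y := M (e |: X).
have eY : e \in Y by apply: (subsetP (closure_ext _ _)); apply: setU11.
have sXY : X \subset Y.
  by apply: subset_trans (closure_ext _ _); apply: subsetUr.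
(* If [F] lay in [Y], an element of [F] outside [X] could be exchanged with [e], putting [e] in
   [F]. *)
have FY : ~~ (val F \subset Y).
  apply/negP => sFY; have /properP[_ [x xF xX]] := XF.
  case/negP: eF; rewrite -pflat_closure.
  have := closure_exchange (subsetP sFY x xF); rewrite fX => /(_ xX).
  apply: subsetP; apply: closure_mono.
  by rewrite subUset sub1set xF proper_sub.
have YB : Y \proper B.
  rewrite properEneq (contraNneq _ FY) => [|->]; last exact: proper_sub.
  apply: closure_sub => //; rewrite subUset sub1set eB.
  exact: subset_trans (proper_sub XF) (proper_sub FB).
pose H : pflat := exist (proper_flat M) _ (proper_flatI (closure_idem M _) YB).
(* A member of [C] above [F] contains [e] and [X], hence [Y]; one below [F] lies in [X], hence in
   [Y]. *)
have CH G : G \in C -> (val G \proper val F) || (e \in val G) && (Y \subset val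
  G).
  move=> GC; have GU := subsetP sC G GC.
  have neGF : G != F by apply: contraNneq FC => <-.
  case/orP: (chF G GC) => [sFG|sGF]; last first.
    by rewrite properEneq (inj_eq val_inj) neGF sGF.
  have eG : e \in val G by apply: aboveF.
  rewrite eG /= closure_sub ?orbT ?pflat_closure //.
  by rewrite subUset sub1set eG (subset_trans (proper_sub XF)).
have HF : H != F by apply: contraNneq eF => <-.
exists H.
  (* [H] is not in [C], being incomparable with [F]: it contains [e] but does not contain [F]. *)
  rewrite !inE negb_or HF /=; apply/negP => HC; have := chF H HC.
  rewrite /comparable (negPf FY) /= => /subsetP/(_ e eY).
  exact/negP.
rewrite (cliquesU1 comparable_refl comparable_sym).
apply/and3P; split.
- apply: inU => //; rewrite inE YB andbT; apply/properP.
  by split; [apply: subset_trans sXY | exists e].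
- by apply/cliquesP.
apply/forall_inP => G GC; rewrite /comparable.
case/orP: (CH G GC) => [GF|/andP[_ ->] //].
by rewrite orbC (subset_trans (maxX G GC GF)).
Qed.

End FlatChains.

(** * Shedding the flats of the augmented Bergman complex *)

Section AugmentedBergman.

Variables (E : finType) (M : matroid E).
Local Notation pflat := {F : {set E} | proper_flat M F}.
Local Notation chains := (cliques (@comparable E M)).
Implicit Types (I : {set E}) (F G : pflat) (C U : {set pflat}).
Implicit Types (S : {set aug_vertex M}).

Definition y_vertex (i : E) : aug_vertex M := inl i.
Definition x_vertex (F : pflat) : aug_vertex M := inr F.
Local Notation y := y_vertex.
Local Notation x := x_vertex.

Lemma y_vertex_inj : injective y. Proof. by move=> i j []. Qed.
Lemma x_vertex_inj : injective x. Proof. by move=> F G []. Qed.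

Lemma im_y_vertex (v : aug_vertex M) :
  (v \in y @: setT) = if v is inl _ then true else false.
Proof. by case: v => [i|F]; [rewrite imset_f|apply/imsetP => -[]]. Qed.

Lemma im_x_vertex (v : aug_vertex M) :
  (v \in x @: setT) = if v is inl _ then false else true.
Proof. by case: v => [i|F]; [apply/imsetP => -[]|rewrite imset_f]. Qed.

Lemma preim_y_yU i S : y @^-1: (y i |: S) = i |: y @^-1: S.
Proof. by apply/setP => j; rewrite !inE (inj_eq y_vertex_inj). Qed.

Lemma preim_x_xU F S : x @^-1: (x F |: S) = F |: x @^-1: S.
Proof. by apply/setP => G; rewrite !inE (inj_eq x_vertex_inj). Qed.

Lemma preim_y_xU F S : y @^-1: (x F |: S) = y @^-1: S.
Proof. by apply/setP => j; rewrite !inE. Qed.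

Lemma preim_x_yU i S : x @^-1: (y i |: S) = x @^-1: S.
Proof. by apply/setP => j; rewrite !inE. Qed.

(** The stage of the shedding at which [U] is the set of remaining flats. Splitting a face by
    preimages confines the effect of adding one vertex to one of the two parts. *)
Definition aug_bergman_on U : {set {set aug_vertex M}} :=
  [set S : {set aug_vertex M} | [&& y @^-1: S \in minor_independent M set0 setT,
    x @^-1: S \in chains U &
    [forall F in x @^-1: S, M (y @^-1: S) \subset val F]]].

Lemma mem_aug_bergman_on U S : (S \in aug_bergman_on U) =
  [&& y @^-1: S \in minor_independent M set0 setT, x @^-1: S \in chains U &
    [forall F in x @^-1: S, M (y @^-1: S) \subset val F]].
Proof. by rewrite inE. Qed.

Lemma aug_bergmanE : aug_bergman M = aug_bergman_on setT.
Proof.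
have indE I : (I \in minor_independent M set0 setT) = independent M I.
  by rewrite inE subsetT independentE; apply: eq_forallb_in => i _;
    rewrite set0U.
have chE C : (C \in chains setT) = [forall F in C, forall G in C,
    (val F \subset val G) || (val G \subset val F)].
  by rewrite inE subsetT.
apply/setP => S; rewrite mem_aug_bergman_on indE chE.
apply/imset2P/idP => [[I C _ + ->]|H].
  have -> : y @^-1: aug_face I C = I.
    by apply/setP => i; rewrite inE aug_faceE.
  have -> : x @^-1: aug_face I C = C.
    by apply/setP => F; rewrite inE aug_faceE.
  by rewrite !inE.
exists (y @^-1: S) (x @^-1: S); rewrite ?inE //.
by apply/setP => -[i|F]; rewrite aug_faceE inE.
Qed.

Lemma aug_bergman_on_complex U : simplicial_complex (aug_bergman_on U).
Proof.
have cI := minor_independent_complex M set0 setT.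
have cC := cliques_complex (@comparable E M) U.
split=> [|S S' sS]; rewrite !mem_aug_bergman_on.
  rewrite !preimset0 cI.1 cC.1 /=.
  by apply/forall_inP => F; rewrite inE.
case/and3P=> I' C' /forall_inP IC'.
have sI := preimsetS y sS; have sC := preimsetS x sS.
rewrite (cI.2 _ _ sI I') (cC.2 _ _ sC C') /=;
  apply/forall_inP => F /(subsetP sC)/IC'.
exact/subset_trans/closure_mono.
Qed.

Lemma VD_aug_bergman_on0 : vertex_decomposable (aug_bergman_on set0).
Proof.
suff -> : aug_bergman_on set0 = push y (minor_independent M set0 setT).
  apply: (VD_push y_vertex_inj); first exact: minor_independent_complex.
  exact: VD_minor_independent.
apply/setP => S; rewrite mem_aug_bergman_on [RHS]inE andbC [RHS]andbC.
case: (_ \in minor_independent _ _ _); rewrite ?andbF // !andbT.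
apply/andP/subsetP => [[/cliquesP[sC _] _] [i|F] vS|sS];
  rewrite ?im_y_vertex //.
  by have := subsetP sC F; rewrite !inE; apply.
have C0 : x @^-1: S = set0.
  by apply/setP => F; rewrite !inE; apply/negP => /sS; rewrite im_y_vertex.
rewrite C0; split; last by apply/forall_inP => F; rewrite inE.
exact: (cliques_complex _ _).1.
Qed.

(** By minimality of [F], every other flat in a chain with [F] lies above it, so the condition on
    the independent part is only that it lies in [F]. The up-set condition [upF] provides the whole
    interval above [F]. *)
Lemma link_aug_bergman_on U F : F \in U ->
  {in U, forall G, comparable F G -> val F \subset val G} ->
  (forall G, val F \subset val G -> G \in U) ->
  link (aug_bergman_on U) (x F) =
    join (y @: setT) (push y (minor_independent M set0 (val F)))
         (push x (chains (flat_interval M (val F) setT))).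
Proof.
move=> FU minF upF; apply/setP => S; rewrite linkE [in RHS]inE.
have cE := cliquesU1 (@comparable_refl E M) (@comparable_sym E M).
rewrite mem_aug_bergman_on preim_y_xU preim_x_xU cE FU !mem_push subsetIr
  !andTb.
have -> : y @^-1: (S :&: y @: setT) = y @^-1: S.
  by apply/setP => i; rewrite !inE im_y_vertex andbT.
have -> : x @^-1: (S :&: ~: (y @: setT)) = x @^-1: S.
  by apply/setP => G; rewrite !inE im_y_vertex andbT.
have -> : S :&: ~: (y @: setT) \subset x @: setT.
  by apply/subsetP => v; rewrite !inE im_y_vertex im_x_vertex;
    case: v => // i; rewrite andbF.
set I := y @^-1: S; set C := x @^-1: S.
have -> : (x F \notin S) = (F \notin C) by rewrite inE.
apply/and3P/andP => [[FC /minor_independentP[_ nI]]|].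
  case/andP=> /andP[/cliquesP[sC rC] /forall_inP rF] /forall_inP leC.
  split.
    apply/minor_independentP; split=> //.
    by apply: subset_trans (leC F (setU11 _ _)); apply: closure_ext.
  apply/cliquesP; split=> //; apply/subsetP => G GC; rewrite inE properT.
  have /andP[_ ->] := valP G; rewrite andbT properEneq (inj_eq val_inj).
  by rewrite minF ?rF ?(subsetP sC) // andbT; apply: contraNneq FC => ->.
case=> /minor_independentP[sI nI] /cliquesP[sC rC].
have FltC G : G \in C -> val F \proper val G.
  by move/(subsetP sC); rewrite inE => /andP[].
split.
- by apply/negP => /FltC; rewrite properxx.
- by apply/minor_independentP; split.
apply/andP; split.
  apply/andP; split.
    by apply/cliquesP; split=> //; apply/subsetP => G /FltC/proper_sub/upF.
  by apply/forall_inP => G /FltC FG; rewrite /comparable proper_sub.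
have sIF : M I \subset val F by apply: closure_sub (pflat_closure F) _.
apply/forall_inP => G /setU1P[-> //|/FltC/proper_sub].
exact: subset_trans.
Qed.

(** The closure of the independent part lies in [F], so adding an [i] outside [F] keeps that part
    independent; if [i] lies in every flat of the chain, so does the new closure. *)
Lemma aug_bergman_on_shedding U F :
  {in U, forall G, comparable F G -> val F \subset val G} ->
  shedding (aug_bergman_on U) (x F).
Proof.
move=> minF S FS.
have cE := cliquesU1 (@comparable_refl E M) (@comparable_sym E M).
rewrite mem_aug_bergman_on preim_y_xU preim_x_xU cE; set I := y @^-1: S;
  set C := x @^-1: S.
case/and3P=> indI /and3P[FU chC /forall_inP rF] /forall_inP leC.
have [sC rC] := cliquesP _ _ _ chC.
have sIF : M I \subset val F by apply: leC; apply: setU11.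
have ltF G : G \in C -> val F \proper val G.
  move=> GC; rewrite properEneq (inj_eq val_inj).
  rewrite minF ?rF ?(subsetP sC) // andbT; apply: contraNneq FS => ->.
  by rewrite inE in GC.
(* Any i outside F in the smallest flat of C, or in E if C is empty. *)
have [i iF iC] : exists2 i, i \notin val F & {in C, forall G, i \in val G}.
  have [C0|[G0 G0C]] := set_0Vmem C.
    have : val F \proper setT by rewrite properT; case/andP: (valP F).
    by case/properP=> _ [i _ iF]; exists i => // G; rewrite C0 inE.
  have [G GC minG] := @arg_minnP _ G0 (mem C) (fun G => #|val G|) G0C.
  have /properP[_ [i iG iF]] := ltF G GC; exists i => // H HC.
  have /orP[/subsetP->//|sHG] := rC _ _ GC HC.
  suff /eqP-> : val H == val G by [].
  by rewrite eqEcard sHG minG.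
have niI : i \notin M I by apply: contra iF; apply: subsetP.
exists (y i).
  rewrite !inE /=; apply: contra niI => iS.
  by apply: (subsetP (closure_ext _ _)); rewrite inE.
rewrite mem_aug_bergman_on preim_y_yU preim_x_yU -/I -/C chC
  minor_independentU1 ?subsetT ?set0U ?niI //=.
  apply/forall_inP => G GC; apply: closure_sub (pflat_closure G) _.
  rewrite subUset sub1set iC //=; apply: subset_trans (closure_ext _ _) _.
  by apply: leC; rewrite inE GC orbT.
by apply: contra niI; apply: (subsetP (closure_ext _ _)).
Qed.

Lemma VD_aug_bergman_on U :
  (forall F G, F \in U -> val F \subset val G -> G \in U) ->
  vertex_decomposable (aug_bergman_on U).
Proof.
have [n] := ubnP #|U|; elim: n U => // n IHn U /ltnSE leUn upU.
have [->|[F0 F0U]] := set_0Vmem U; first exact: VD_aug_bergman_on0.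
(* A flat of least cardinality is minimal in [U], so removing it leaves an up-set. *)
have [F FU minF] := @arg_minnP _ F0 (mem U) (fun F => #|val F|) F0U.
have {}FU : F \in U by [].
have {}minF : {in U, forall G, comparable F G -> val F \subset val G}.
  move=> G GU /orP[//|sGF]; suff /eqP-> : val G == val F by [].
  by rewrite eqEcard sGF minF.
have cU := aug_bergman_on_complex U.
have cE := cliquesU1 (@comparable_refl E M) (@comparable_sym E M).
apply: (VD_shedding (v := x F)) => //.
- rewrite -(setU0 [set x F]) mem_aug_bergman_on preim_y_xU preim_x_xU
  !preimset0 cE FU.
  rewrite (minor_independent_complex _ _ _).1 (cliques_complex _ _).1 /=.
  apply/andP; split; apply/forall_inP => G; first by rewrite inE.
  rewrite !inE orbF => /eqP->; apply: closure_sub (pflat_closure F) _.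
  exact: sub0set.
- suff -> : deletion (aug_bergman_on U) (x F) = aug_bergman_on (U :\ F).
    apply: IHn => [|G H /setD1P[neGF GU] sGH].
      by apply: leq_trans leUn; rewrite [ltnRHS](cardsD1 F) FU.
    rewrite in_setD1 (upU _ _ GU) // andbT; apply: contraNneq neGF => eHF.
    rewrite -(inj_eq val_inj) eqEsubset -{1}eHF sGH minF //.
    by rewrite /comparable -eHF sGH orbT.
  apply/setP => S; rewrite deletionE // !mem_aug_bergman_on !inE subsetD1 inE.
  by rewrite -!andbA; do !bool_congr.
- rewrite link_aug_bergman_on // => [|G]; last exact: upU.
  apply: VD_join.
  + exact/push_complex/minor_independent_complex.
  + exact/push_complex/cliques_complex.
  + by move=> S; rewrite inE => /andP[].
  + move=> S; rewrite inE => /andP[/subsetP sS _]; apply/subsetP => v /sS.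
    by rewrite inE im_y_vertex im_x_vertex; case: v.
  + apply: (VD_push y_vertex_inj); first exact: minor_independent_complex.
    exact: VD_minor_independent.
  + apply: (VD_push x_vertex_inj); first exact: cliques_complex.
    apply: VD_flat_interval; rewrite ?subsetT ?pflat_closure //.
    by apply/eqP; rewrite -subTset closure_ext.
exact: aug_bergman_on_shedding.
Qed.

End AugmentedBergman.

Theorem theorem1p1 (E : finType) (M : matroid E) :
  vertex_decomposable (aug_bergman M).
Proof. by rewrite aug_bergmanE; apply: VD_aug_bergman_on => F G;
  rewrite !inE. Qed.
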